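(* Let $W(y,z|x)$ be a discrete memoryless wiretap channel (not assumed degraded) with finite alphabets $\mathcal{X},\mathcal{Y},\mathcal{Z}$. Then for every $\epsilon\in[0,1)$, \[ \mathcal{C}_s(\epsilon|W)=\mathcal{C}_s(0|W), \] where $\mathcal{C}_s(\epsilon|W)$ is the maximal $\epsilon$-achievable rate over sequences of codes satisfying the secrecy condition $\lim_{n\to\infty}\frac1n I(M_n;Z^n)=0$ (all terms as defined in the context).
   Context: A discrete memoryless wiretap channel has a transmitter with input alphabet $\mathcal{X}$, a legitimate receiver observing $\mathcal{Y}$ and an eavesdropper observing $\mathcal{Z}$ (finite sets), with $n$-letter channel $W^n(y^n,z^n|x^n)=\prod_{t=1}^n W(y_t,z_t|x_t)$. A code of length $n$ consists of a finite message set $\mathcal{M}_n$, a stochastic encoder $\phi^{(n)}(x^n|m)$ (a conditional pmf on $\mathcal{X}^n$ given $m\in\mathcal{M}_n$) and a decoder $\psi^{(n)}:\mathcal{Y}^n\to\mathcal{M}_n$. The induced joint pmf is $p_{M_nX^nY^nZ^n}(m,x^n,y^n,z^n)=\frac{1}{|\mathcal{M}_n|}\phi^{(n)}(x^n|m)\prod_{t=1}^n W(y_t,z_t|x_t)$ (message uniform). The probability of correct decoding is $P_c^{(n)}=\Pr\{\psi^{(n)}(Y^n)=M_n\}$ and the error probability is $P_e^{(n)}=1-P_c^{(n)}$. For $\epsilon\in[0,1)$, a rate $R$ is $\epsilon$-achievable if there is a sequence of codes $\{(\phi^{(n)},\psi^{(n)})\}_{n\ge1}$ with $\limsup_{n\to\infty}P_e^{(n)}\le\epsilon$,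 $\liminf_{n\to\infty}\frac1n\log|\mathcal{M}_n|\ge R$, and $\lim_{n\to\infty}\frac1n I(M_n;Z^n)=0$. $\mathcal{C}_s(\epsilon|W)$ denotes the supremum of $\epsilon$-achievable rates. (It is known, by Csiszár–Körner, that $\mathcal{C}_s(0|W)=\max I(U;Y)-I(U;Z)$, the maximum over joint pmfs $p_{UXYZ}$ with $|\mathcal{U}|\le|\mathcal{X}|$, $p_{YZ|X}=W$, and $U\to X\to(Y,Z)$ a Markov chain.) *)

(* Defs.v *)
From HB Require Import structures.
From mathcomp Require Import all_boot all_order all_algebra.
From mathcomp Require Import all_classical all_reals all_analysis.
Unset Printing Implicit Defensive.
Import Order.TTheory GRing.Theory Num.Theory.
Import numFieldNormedType.Exports.
Local Open Scope classical_set_scope.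
Local Open Scope ring_scope.

Section Wiretap.
Variables (R : realType) (X Y Z : finType).

Definition is_channel (W : X -> Y -> Z -> R) : Prop :=
  (forall x y z, 0 <= W x y z) /\ (forall x, \sum_(y : Y) \sum_(z : Z) W x y z = 1).

Definition chanN (W : X -> Y -> Z -> R) {n} (x : {ffun 'I_n -> X})
  (y : {ffun 'I_n -> Y}) (z : {ffun 'I_n -> Z}) : R :=
  \prod_(t < n) W (x t) (y t) (z t).

Record code (n : nat) := Code {
  msize : nat;
  msize_gt0 : (0 < msize)%N;
  enc : 'I_msize -> {ffun 'I_n -> X} -> R;
  enc_ge0 : forall m x, 0 <= enc m x;
  enc_sum1 : forall m, \sum_(x : {ffun 'I_n -> X}) enc m x = 1;
  dec : {ffun 'I_n -> Y} -> 'I_msize }.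
Arguments msize {n}.
Arguments enc {n}.
Arguments dec {n}.

Variable W : X -> Y -> Z -> R.

Definition pjoint {n} (c : code n) (m : 'I_(msize c)) x y z : R :=
  (msize c)%:R^-1 * enc c m x * chanN W x y z.

Definition Pc {n} (c : code n) : R :=
  \sum_(m : 'I_(msize c)) \sum_(x : {ffun 'I_n -> X}) \sum_(y : {ffun 'I_n -> Y})
    \sum_(z : {ffun 'I_n -> Z}) (if dec c y == m then pjoint c m x y z else 0).

Definition Pe {n} (c : code n) : R := 1 - Pc c.

Definition pMZ {n} (c : code n) (m : 'I_(msize c)) (z : {ffun 'I_n -> Z}) : R :=
  \sum_(x : {ffun 'I_n -> X}) \sum_(y : {ffun 'I_n -> Y}) pjoint c m x y z.
Definition pM {n} (c : code n) (m : 'I_(msize c)) : R := (msize c)%:R^-1.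
Definition pZ {n} (c : code n) (z : {ffun 'I_n -> Z}) : R :=
  \sum_(m : 'I_(msize c)) pMZ c m z.

Definition mutinfoMZ {n} (c : code n) : R :=
  \sum_(m : 'I_(msize c)) \sum_(z : {ffun 'I_n -> Z})
    (if pMZ c m z == 0 then 0
     else pMZ c m z * ln (pMZ c m z / (pM c m * pZ c z))).

Definition eps_achievable (eps r : R) : Prop :=
  exists C : forall n, code n,
    (limn_esup (fun n => (Pe (C n))%:E) <= eps%:E)%E /\
    (r%:E <= limn_einf (fun n => (ln ((msize (C n))%:R) / n%:R)%:E))%E /\
    (fun n => mutinfoMZ (C n) / n%:R) @ \oo --> (0 : R).

Definition Cs (eps : R) : \bar R :=
  ereal_sup [set r%:E | r in [set r | eps_achievable eps r]].

End Wiretap.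
Arguments is_channel {R X Y Z}.
Arguments Cs {R X Y Z}.

(* Main.v *)
Require Import Defs.
From HB Require Import structures.
From mathcomp Require Import all_boot all_order all_algebra.
From mathcomp Require Import all_classical all_reals all_analysis.
From mathcomp Require Import ring lra.
Import Order.TTheory GRing.Theory Num.Theory.
Import numFieldNormedType.Exports.
Local Open Scope ring_scope.

(** Good codes are manufactured directly out of the given [eps]-codes, without
    single-letterization. Let a code of length [n] have success probability at
    least [eta] and leakage [I = o(n)].

    - A fraction at least [eta / 8] of the messages can be kept such that, after
      conditioning the encoder on a suitable set of words, every word sent is
      decoded correctly with probability at least [eta / 2]; the law of [Z^n]
      given a kept message grows at most by the factor [8 / eta], so its
      divergence from the law of [Z^n] is still [O(I + 1)].
    - By the blowing-up lemma, enlarging the decoding sets by a Hamming radius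
      [kappa * n] makes the sent message belong to a decoded list of size
      [exp (o (n))] with probability close to 1.
    - An outer code of length [k] over the alphabet of kept messages resolves the
      lists at a small loss of rate. As the divergences from a product law add
      up, its leakage is at most [k * O(I + 1)] for any outer codebook, which
      is a vanishing fraction of [k * n] when [n] is large: no further secrecy
      coding is needed.

    Letting [n], then [k], grow gives error and leakage tending to 0. *)

(** * Divergence, mixtures and averaging over finite sets *)

Section FiniteLaws.
Context {R : realType}.

Definition is_pmf {T : finType} (p : T -> R) :=
  (forall t, 0 <= p t) /\ \sum_t p t = 1.

(** Absolute continuity. Only under it is [kl] the relative entropy: a term with [q t = 0] evaluates
    to 0 and not to infinity, because [x / 0 = 0] and [ln 0 = 0]. *)
Definition dominated {T : finType} (p q : T -> R) :=
  forall t, q t = 0 -> p t = 0.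

Definition kl {T : finType} (p q : T -> R) : R :=
  \sum_t p t * ln (p t / q t).

(** This is ln x <= x - 1 at x = q / p. Summed, it is Gibbs' inequality; termwise, it makes p ln (p
    / q) + q nonnegative. *)
Lemma kl_term_ge (p q : R) : 0 <= p -> 0 <= q -> (q = 0 -> p = 0) ->
  p - q <= p * ln (p / q).
Proof.
move=> p0 q0 pq; have [->|pn0] := eqVneq p 0; first by rewrite mul0r; lra.
have qn0 : q != 0 by apply: contra_neq pn0.
have {p0}p0 : 0 < p by rewrite lt_def pn0.
have {q0}q0 : 0 < q by rewrite lt_def qn0.
have qp0 : 0 < q / p by rewrite divr_gt0.
have : ln (1 + (q / p - 1)) <= q / p - 1 by apply: le_ln1Dx; lra.
have -> : 1 + (q / p - 1) = (p / q)^-1 by rewrite invf_div; ring.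
rewrite lnV ?posrE ?divr_gt0 // => h.
have : p * (1 - q / p) <= p * ln (p / q) by rewrite ler_pM2l //; lra.
by rewrite mulrBr mulr1 mulrCA divff // mulr1.
Qed.

Lemma kl_ge0 {T : finType} (p q : T -> R) :
  is_pmf p -> is_pmf q -> dominated p q -> 0 <= kl p q.
Proof.
move=> [p0 p1] [q0 q1] pq.
have <- : \sum_t (p t - q t) = 0 by rewrite sumrB p1 q1 subrr.
by apply: ler_sum => t _; apply: kl_term_ge => //; exact: pq.
Qed.

Lemma kl_self {T : finType} (p : T -> R) : kl p p = 0.
Proof.
apply: big1 => t _; have [->|p0] := eqVneq (p t) 0; first by rewrite mul0r.
by rewrite divff // ln1 mulr0.
Qed.

(** The density with respect to [q] grows at most by the factor [b], which costs [ln b]. The terms p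
    ln (p / q) can be negative; adding [q], of total mass 1, makes them nonnegative, so that they
    may be scaled by [b]. *)
Lemma kl_le_scaled {T : finType} (b : R) (p' p q : T -> R) :
    0 < b -> is_pmf p' -> is_pmf p -> is_pmf q -> dominated p q ->
    (forall t, p' t <= b * p t) ->
  kl p' q <= ln b + b * (kl p q + 1).
Proof.
move=> b0 [p'0 p'1] [p0 p1] [q0 q1] pq p'p.
have -> : ln b + b * (kl p q + 1) =
    \sum_t (p' t * ln b + b * (p t * ln (p t / q t) + q t)).
  by rewrite big_split /= -mulr_suml p'1 mul1r -mulr_sumr big_split /= q1.
apply: ler_sum => t _.
have g0 : 0 <= p t * ln (p t / q t) + q t.
  by have := @kl_term_ge (p t) (q t) (p0 t) (q0 t) (pq t); have := p0 t; lra.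
have [->|p'n0] := eqVneq (p' t) 0.
  by rewrite !mul0r add0r mulr_ge0 // ltW.
have p't : 0 < p' t by rewrite lt_def p'n0 /=.
have pt : 0 < p t by rewrite -(pmulr_rgt0 _ b0); exact: lt_le_trans (p'p t).
have qt : 0 < q t.
  by rewrite lt_def q0 andbT; apply/eqP => /pq pt0; rewrite pt0 ltxx in pt.
have l1 : ln (p' t / q t) <= ln b + ln (p t / q t).
  rewrite -lnM ?posrE ?divr_gt0 // ler_ln ?posrE ?divr_gt0 ?mulr_gt0 ?invr_gt0 //.
  by rewrite mulrA ler_pM2r ?invr_gt0.
have l2 : p' t * ln (p' t / q t) <= p' t * (ln b + ln (p t / q t)).
  by rewrite ler_pM2l.
apply: (le_trans l2); rewrite mulrDr lerD2l.
have [l0|l0] := leP 0 (ln (p t / q t)).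
  have : p' t * ln (p t / q t) <= b * p t * ln (p t / q t) by rewrite ler_wpM2r.
  by have := mulr_ge0 (ltW b0) (q0 t); rewrite mulrDr mulrA; lra.
have : p' t * ln (p t / q t) <= 0 by rewrite pmulr_rle0 // ltW.
by have := mulr_ge0 (ltW b0) g0; lra.
Qed.

Definition mixture {M T : finType} (p : M -> T -> R) (t : T) : R :=
  #|M|%:R^-1 * \sum_m p m t.

Lemma mixture_pmf {M T : finType} (p : M -> T -> R) :
  (0 < #|M|)%N -> (forall m, is_pmf (p m)) -> is_pmf (mixture p).
Proof.
move=> M0 hp; split=> [t|].
  by rewrite mulr_ge0 ?invr_ge0 ?ler0n ?sumr_ge0 // => m _; case: (hp m).
rewrite -mulr_sumr exchange_big /= (eq_bigr (fun=> 1)) => [|m _]; last by case: (hp m).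
by rewrite sumr_const mulVf // pnatr_eq0 -lt0n.
Qed.

Lemma dominated_mixture {M T : finType} (p : M -> T -> R) m :
  (0 < #|M|)%N -> (forall m, is_pmf (p m)) -> dominated (p m) (mixture p).
Proof.
move=> M0 hp t /eqP; rewrite mulf_eq0 invr_eq0 pnatr_eq0 -leqn0 leqNgt M0 /=.
rewrite psumr_eq0 => [|i _]; last by case: (hp i).
by move=> /allP /(_ m (mem_index_enum _)) /= /eqP.
Qed.

(** Compensation identity: replacing the mixture by [q] raises the sum by [#|M|] times the
    divergence of the mixture from [q]. *)
Lemma kl_mixture {M T : finType} (p : M -> T -> R) (q : T -> R) :
    (0 < #|M|)%N -> (forall m, is_pmf (p m)) -> is_pmf q ->
    (forall m, dominated (p m) q) ->
  0 <= \sum_m kl (p m) (mixture p) <= \sum_m kl (p m) q.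
Proof.
move=> M0 hp hq pq; set pbar := mixture p.
have hpbar : is_pmf pbar := mixture_pmf p M0 hp.
have pbar0 m : dominated (p m) pbar := dominated_mixture p m M0 hp.
have pbarq : dominated pbar q.
  by move=> t qt; rewrite /pbar /mixture big1 ?mulr0 // => m _; exact: pq.
apply/andP; split.
  by apply: sumr_ge0 => m _; exact: kl_ge0.
rewrite -subr_ge0 -sumrB.
have -> : \sum_m (kl (p m) q - kl (p m) pbar) = #|M|%:R * kl pbar q.
  rewrite mulr_sumr.
  transitivity (\sum_m \sum_t p m t * ln (pbar t / q t)).
    apply: eq_bigr => m _; rewrite -sumrB; apply: eq_bigr => t _.
    have [->|pn0] := eqVneq (p m t) 0; first by rewrite !mul0r subrr.
    have p0 : 0 < p m t by rewrite lt_def pn0 /=; case: (hp m).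
    have b0 : 0 < pbar t.
      by rewrite lt_def (proj1 hpbar) andbT; apply: contra_neq pn0; exact: pbar0.
    have q0 : 0 < q t.
      by rewrite lt_def (proj1 hq) andbT; apply: contra_neq pn0; exact: pq.
    by rewrite !ln_div ?posrE //; ring.
  rewrite exchange_big /=; apply: eq_bigr => t _.
  rewrite -mulr_suml mulrA; congr (_ * _).
  by rewrite mulrA divff ?mul1r // pnatr_eq0 -lt0n.
by rewrite mulr_ge0 ?ler0n //; exact: kl_ge0.
Qed.

(** Reverse Markov inequality: [h m] is at most [theta] plus the indicator of [theta <= h m]. *)
Lemma card_ge_mean {M : finType} (h : M -> R) (theta : R) :
    (forall m, h m <= 1) -> 0 <= theta -> #|M|%:R * (2 * theta) <= \sum_m h m ->
  #|M|%:R * theta <= #|[set m | theta <= h m]|%:R.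
Proof.
move=> h1 th0 hs.
have : \sum_m h m <= \sum_m ((theta <= h m)%R%:R + theta).
  apply: ler_sum => m _; case: (leP theta (h m)) => hm /=.
    by rewrite (le_trans (h1 m)) // lerDl.
  by rewrite add0r ltW.
have -> : \sum_m ((theta <= h m)%R%:R + theta) =
    #|[set m | theta <= h m]|%:R + #|M|%:R * theta.
  rewrite big_split /= sumr_const -[theta *+ _]mulr_natl; congr (_ + _).
  rewrite -sum1dep_card natr_sum [RHS]big_mkcond /=.
  by apply: eq_bigr => m _; case: ifP.
by move=> hs'; have := le_trans hs hs'; lra.
Qed.

End FiniteLaws.

(** * Concatenated words, product laws and memoryless channels *)

Section Concatenation.
Context {R : realType}.

Definition lpart {n m} {T : Type} (f : {ffun 'I_(n + m) -> T}) :
  {ffun 'I_n -> T} := [ffun i => f (lshift m i)].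
Definition rpart {n m} {T : Type} (f : {ffun 'I_(n + m) -> T}) :
  {ffun 'I_m -> T} := [ffun i => f (rshift n i)].

Definition cat_law {n m} {T : Type} (p : {ffun 'I_n -> T} -> R)
    (q : {ffun 'I_m -> T} -> R) (f : {ffun 'I_(n + m) -> T}) : R :=
  p (lpart f) * q (rpart f).

Definition fcat {n m} {T : Type} (a : {ffun 'I_n -> T}) (b : {ffun 'I_m -> T}) :
  {ffun 'I_(n + m) -> T} :=
  [ffun i => match fintype.split i with inl j => a j | inr j => b j end].

Lemma lpart_fcat {n m} {T : Type} (a : {ffun 'I_n -> T}) (b : {ffun 'I_m -> T}) :
  lpart (fcat a b) = a.
Proof. by apply/ffunP => i; rewrite !ffunE (unsplitK (inl i)). Qed.

Lemma rpart_fcat {n m} {T : Type} (a : {ffun 'I_n -> T}) (b : {ffun 'I_m -> T}) :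
  rpart (fcat a b) = b.
Proof. by apply/ffunP => i; rewrite !ffunE (unsplitK (inr i)). Qed.

Lemma fcat_parts {n m} {T : Type} (f : {ffun 'I_(n + m) -> T}) :
  fcat (lpart f) (rpart f) = f.
Proof.
apply/ffunP => i; rewrite ffunE -{2}(splitK i).
by case: (fintype.split i) => j; rewrite ffunE.
Qed.

Lemma sum_fcat {n m} {T : finType} (F : {ffun 'I_(n + m) -> T} -> R) :
  \sum_f F f = \sum_a \sum_b F (fcat a b).
Proof.
rewrite pair_bigA /=.
rewrite (reindex (fun p : {ffun 'I_n -> T} * {ffun 'I_m -> T} => fcat p.1 p.2)) //.
exists (fun f => (lpart f, rpart f)) => [[a b]|f] _ /=; last exact: fcat_parts.
by rewrite lpart_fcat rpart_fcat.
Qed.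

Lemma sum_cat {n m} {T : finType} (F : {ffun 'I_n -> T} -> {ffun 'I_m -> T} -> R) :
  \sum_f F (lpart f) (rpart f) = \sum_a \sum_b F a b.
Proof.
rewrite sum_fcat; apply: eq_bigr => a _; apply: eq_bigr => b _.
by rewrite lpart_fcat rpart_fcat.
Qed.

Lemma sum_cat_law {n m} {T : finType} (p : {ffun 'I_n -> T} -> R)
    (q : {ffun 'I_m -> T} -> R) F G :
  \sum_f cat_law p q f * (F (lpart f) * G (rpart f)) =
  (\sum_a p a * F a) * (\sum_b q b * G b).
Proof.
rewrite (sum_cat (fun a b => p a * q b * (F a * G b))) mulr_suml.
by apply: eq_bigr => a _; rewrite mulr_sumr; apply: eq_bigr => b _; ring.
Qed.

Lemma pmf_cat {n m} {T : finType} (p : {ffun 'I_n -> T} -> R)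
    (q : {ffun 'I_m -> T} -> R) : is_pmf p -> is_pmf q -> is_pmf (cat_law p q).
Proof.
move=> [p0 p1] [q0 q1]; split=> [f|]; first exact: mulr_ge0.
rewrite (sum_cat (fun a b => p a * q b)).
under eq_bigr do rewrite -mulr_sumr q1 mulr1.
exact: p1.
Qed.

Lemma dominated_cat {n m} {T : finType} (p p' : {ffun 'I_n -> T} -> R)
    (q q' : {ffun 'I_m -> T} -> R) : dominated p p' -> dominated q q' ->
  dominated (cat_law p q) (cat_law p' q').
Proof.
move=> pp qq f /eqP; rewrite mulf_eq0 /cat_law.
by case/orP=> /eqP; [move/pp->; rewrite mul0r|move/qq->; rewrite mulr0].
Qed.

(** The logarithm of the product splits and the other factor sums to 1. This additivity is what
    bounds the leakage of [k] blocks by [k] times that of one block. *)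
Lemma kl_cat {n m} {T : finType} (p p' : {ffun 'I_n -> T} -> R)
    (q q' : {ffun 'I_m -> T} -> R) :
    is_pmf p -> is_pmf p' -> is_pmf q -> is_pmf q' -> dominated p p' -> dominated q q' ->
  kl (cat_law p q) (cat_law p' q') = kl p p' + kl q q'.
Proof.
move=> [p0 p1] [p'0 _] [q0 q1] [q'0 _] pp qq.
rewrite /kl (sum_cat (fun a b => p a * q b * ln (p a * q b / (p' a * q' b)))).
have -> : \sum_a p a * ln (p a / p' a) + \sum_b q b * ln (q b / q' b) =
  \sum_a \sum_b (q b * (p a * ln (p a / p' a)) + p a * (q b * ln (q b / q' b))).
  under [RHS]eq_bigr do rewrite big_split /= -mulr_suml q1 mul1r -mulr_sumr.
  by rewrite big_split /= -mulr_suml p1 mul1r.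
apply: eq_bigr => a _; apply: eq_bigr => b _.
have [->|pn0] := eqVneq (p a) 0; first by rewrite !(mul0r, mulr0) addr0.
have [->|qn0] := eqVneq (q b) 0; first by rewrite !(mul0r, mulr0) addr0.
have pa : 0 < p a by rewrite lt_def pn0 p0.
have qb : 0 < q b by rewrite lt_def qn0 q0.
have p'a : 0 < p' a by rewrite lt_def p'0 andbT; apply: contra_neq pn0; exact: pp.
have q'b : 0 < q' b by rewrite lt_def q'0 andbT; apply: contra_neq qn0; exact: qq.
by rewrite !ln_div ?posrE ?mulr_gt0 // !lnM ?posrE //; ring.
Qed.

Definition stochastic {A B : finType} (V : A -> B -> R) := forall a, is_pmf (V a).

Definition prod_law {B : finType} {n} (p : 'I_n -> B -> R)
    (b : {ffun 'I_n -> B}) : R := \prod_t p t (b t).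

Lemma pmf_prod {B : finType} {n} (p : 'I_n -> B -> R) :
  (forall t, is_pmf (p t)) -> is_pmf (prod_law p).
Proof.
move=> hp; split=> [b|]; first by apply: prodr_ge0 => t _; case: (hp t).
rewrite -(bigA_distr_bigA p) big1 // => t _.
by case: (hp t).
Qed.

(** Output law of the memoryless channel [V] fed with a random word of law [e]. *)
Definition out {A B : finType} (V : A -> B -> R) {n}
    (e : {ffun 'I_n -> A} -> R) (b : {ffun 'I_n -> B}) : R :=
  \sum_a e a * prod_law (fun t => V (a t)) b.

Lemma pmf_out {A B : finType} {V : A -> B -> R} {n} {e : {ffun 'I_n -> A} -> R} :
  stochastic V -> is_pmf e -> is_pmf (out V e).
Proof.
move=> hV [e0 e1].
have h a := @pmf_prod B n (fun t => V (a t)) (fun t => hV (a t)).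
split=> [b|].
  by apply: sumr_ge0 => a _; rewrite mulr_ge0 //; case: (h a).
rewrite exchange_big /= -[RHS]e1; apply: eq_bigr => a _.
by rewrite -mulr_sumr; case: (h a) => _ ->; rewrite mulr1.
Qed.

Lemma out_cat {A B : finType} (V : A -> B -> R) {n m}
    (e : {ffun 'I_n -> A} -> R) (e' : {ffun 'I_m -> A} -> R) b :
  out V (cat_law e e') b = cat_law (out V e) (out V e') b.
Proof.
rewrite /cat_law /out /prod_law big_distrlr /=.
rewrite -(sum_cat (fun a a' => e a * (\prod_t V (a t) (lpart b t)) *
   (e' a' * \prod_t V (a' t) (rpart b t)))).
apply: eq_bigr => a _; rewrite big_split_ord /=.
under eq_bigr do rewrite -(ffunE (fun i => a (lshift m i))) -(ffunE (fun i => b (lshift m i))).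
under [X in _ * (_ * X)]eq_bigr do
  rewrite -(ffunE (fun i => a (rshift n i))) -(ffunE (fun i => b (rshift n i))).
by rewrite -!/(lpart _) -!/(rpart _); ring.
Qed.

Lemma out_le {A B : finType} (V : A -> B -> R) {n} (e e' : {ffun 'I_n -> A} -> R) c b :
  stochastic V -> (forall a, e a <= c * e' a) -> out V e b <= c * out V e' b.
Proof.
move=> hV ee; rewrite /out /prod_law mulr_sumr; apply: ler_sum => a _.
rewrite mulrA ler_wpM2r // prodr_ge0 // => t _.
by case: (hV (a t)).
Qed.

End Concatenation.

(** * The blowing-up lemma by a variance bound, and the size of Hamming balls *)

Section BlowingUp.
Context {R : realType} {B : finType}.

Definition hamming {n} (y y' : {ffun 'I_n -> B}) : nat := \sum_i (y i != y' i).

Lemma hammingxx {n} (y : {ffun 'I_n -> B}) : hamming y y = 0%N.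
Proof. by apply: big1 => i _; rewrite eqxx. Qed.

Lemma hamming_triangle {n} (x y z : {ffun 'I_n -> B}) :
  (hamming x z <= hamming x y + hamming y z)%N.
Proof.
rewrite -big_split /=; apply: leq_sum => i _.
by have [->|] := eqVneq (x i) (y i) => //= _; case: (_ != _).
Qed.

Lemma hamming_fcat {n m} (a a' : {ffun 'I_n -> B}) (b b' : {ffun 'I_m -> B}) :
  hamming (fcat a b) (fcat a' b') = (hamming a a' + hamming b b')%N.
Proof.
rewrite /hamming big_split_ord /=; congr (_ + _)%N; apply: eq_bigr => i _.
  by rewrite !ffunE (unsplitK (inl i)).
by rewrite !ffunE (unsplitK (inr i)).
Qed.

Lemma hamming_le {n} (y y' : {ffun 'I_n -> B}) : (hamming y y' <= n)%N.
Proof.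
rewrite -[leqRHS]card_ord -sum1_card; apply: leq_sum => i _.
by case: (_ != _).
Qed.

Lemma sqr_dev_le {T : finType} (mu f : T -> R) c t :
    is_pmf mu -> (forall s s', f s - f s' <= c) ->
  (f t - \sum_s mu s * f s) ^+ 2 <= c ^+ 2.
Proof.
move=> [mu0 mu1] fc.
have -> : f t - \sum_s mu s * f s = \sum_s mu s * (f t - f s).
  under [RHS]eq_bigr do rewrite mulrBr.
  by rewrite sumrB -mulr_suml mu1 mul1r.
have c0 : 0 <= c by have := fc t t; rewrite subrr.
rewrite -[leLHS]real_normK ?num_real // lerXn2r ?nnegrE //.
rewrite (le_trans (ler_norm_sum _ _ _)) // -[leRHS]mul1r -mu1 mulr_suml.
apply: ler_sum => s _; rewrite normrM ger0_norm // ler_wpM2l //.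
by rewrite ler_norml fc andbT; have := fc s t; lra.
Qed.

(** Bias-variance decomposition: the cross term vanishes because deviations from the mean average to
    0. *)
Lemma variance_shift {T : finType} (mu f : T -> R) c : is_pmf mu ->
  \sum_t mu t * (f t - c) ^+ 2 =
  \sum_t mu t * (f t - \sum_s mu s * f s) ^+ 2 + (\sum_s mu s * f s - c) ^+ 2.
Proof.
move=> [mu0 mu1]; set m := \sum_s mu s * f s.
have -> : (m - c) ^+ 2 = \sum_t mu t * ((m - c) ^+ 2) by rewrite -mulr_suml mu1 mul1r.
rewrite -big_split /=; apply/eqP; rewrite -subr_eq0 -sumrB; apply/eqP.
have -> : \sum_t (mu t * (f t - c) ^+ 2 -
    (mu t * (f t - m) ^+ 2 + mu t * (m - c) ^+ 2)) =
    2 * (m - c) * (\sum_t (mu t * f t - mu t * m)).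
  by rewrite mulr_sumr; apply: eq_bigr => t _; ring.
by rewrite sumrB -mulr_suml mu1 mul1r subrr mulr0.
Qed.

(* Efron-Stein: conditioning on all coordinates but the first splits the
   variance, and each coordinate contributes at most 1. *)
Lemma lipschitz_variance {n} (p : 'I_n -> B -> R) (f : {ffun 'I_n -> B} -> R) :
    (forall t, is_pmf (p t)) ->
    (forall y y', f y - f y' <= (hamming y y')%:R) ->
  \sum_y prod_law p y * (f y - \sum_y' prod_law p y' * f y') ^+ 2 <= n%:R.
Proof.
elim: n p f => [|n IH] p f hp fL; set mu := prod_law p; have hmu : is_pmf mu := pmf_prod p hp.
  rewrite big1 // => y _; apply/eqP; rewrite mulf_eq0; apply/orP; right.
  rewrite eq_le sqr_ge0 andbT -[leRHS](expr0n R 2).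
  apply: sqr_dev_le => // s s'.
  by rewrite (le_trans (fL s s')) // (ler_nat _ _ 0) hamming_le.
pose p1 (t : 'I_1) := p (lshift n t : 'I_(1 + n)).
pose p2 (t : 'I_n) := p (rshift 1 t : 'I_(1 + n)).
pose mu1 := prod_law p1.
pose mu2 := prod_law p2.
have hmu1 : is_pmf mu1 by apply: pmf_prod => t; exact: hp.
have hmu2 : is_pmf mu2 by apply: pmf_prod => t; exact: hp.
have muE a b : mu (@fcat 1 n B a b) = mu1 a * mu2 b.
  rewrite /mu /prod_law (@big_split_ord _ _ _ 1 n) /=; congr (_ * _); apply: eq_bigr => i _.
    by rewrite !ffunE (unsplitK (inl i)).
  by rewrite !ffunE (unsplitK (inr i)).
(* Averaging out the first letter keeps the function 1-Lipschitz, so the induction hypothesis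
   applies to [g]. *)
pose g b := \sum_a mu1 a * f (@fcat 1 n B a b).
have gL b b' : g b - g b' <= (hamming b b')%:R.
  rewrite -sumrB; apply: (@le_trans _ _ (\sum_a mu1 a * (hamming b b')%:R)); last first.
    by rewrite -mulr_suml (proj2 hmu1) mul1r.
  apply: ler_sum => a _; rewrite -mulrBr ler_wpM2l //; first by case: hmu1.
  by rewrite (le_trans (fL _ _)) // (@hamming_fcat 1 n) hammingxx add0n.
have E : \sum_y mu y * f y = \sum_b mu2 b * g b.
  rewrite (@sum_fcat _ 1 n) exchange_big /=; apply: eq_bigr => b _.
  by rewrite mulr_sumr; apply: eq_bigr => a _; rewrite muE; ring.
rewrite E (@sum_fcat _ 1 n) exchange_big /=.
have -> : n.+1%:R = \sum_b mu2 b * 1 + n%:R :> R.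
  by rewrite -mulr_suml (proj2 hmu2) mulr1 -natr1 addrC.
apply: (@le_trans _ _ (\sum_b mu2 b * 1 +
    \sum_b mu2 b * (g b - \sum_b' mu2 b' * g b') ^+ 2)); last first.
  by rewrite lerD2l; apply: IH => // t; exact: hp.
rewrite -big_split /=; apply: ler_sum => b _.
under eq_bigr do rewrite muE [mu1 _ * _]mulrC -mulrA.
rewrite -mulr_sumr -mulrDr ler_wpM2l //; first by case: hmu2.
rewrite variance_shift // lerD2r.
rewrite -[leRHS](proj2 hmu1); apply: ler_sum => a _.
rewrite ler_piMr //; first by case: hmu1.
rewrite -[leRHS](expr1n R 2).
apply: (@sqr_dev_le _ _ (fun a => f (@fcat 1 n B a b))) => // s s'.
rewrite (le_trans (fL _ _)) // (@hamming_fcat 1 n) hammingxx addn0 (ler_nat _ _ 1).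
exact: hamming_le.
Qed.

Definition near_set {n} (kappa : R) (D : pred {ffun 'I_n -> B})
    (y : {ffun 'I_n -> B}) : bool :=
  [exists y', D y' && ((hamming y y')%:R <= kappa * n%:R)].

(** The distance to [D] is 1-Lipschitz, hence of variance at most [n]. As it vanishes on [D], its
    mean [E] satisfies [theta * E ^+ 2 <= n]. The first bound on [n] makes [E] at most half the
    radius; the second turns Chebyshev's inequality into the bound [tau]. *)
Lemma blowing_up {n} (p : 'I_n -> B -> R) (D : pred {ffun 'I_n -> B})
    (theta kappa tau : R) : (forall t, is_pmf (p t)) ->
    0 < theta -> 0 < kappa -> 0 < tau ->
    4 <= theta * kappa ^+ 2 * n%:R -> 4 <= tau * kappa ^+ 2 * n%:R ->
    theta <= \sum_(y | D y) prod_law p y ->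
  \sum_(y | ~~ near_set kappa D y) prod_law p y <= tau.
Proof.
move=> hp th0 ka0 ta0 nth nta; set mu := prod_law p => hD.
have [y0 Dy0] : exists y0, D y0.
  apply/existsP; apply: contraTT hD => /existsPn hD.
  by rewrite -ltNge big_pred0 // => y; apply/negbTE; exact: hD.
have [mu0 mu1] : is_pmf mu by exact: pmf_prod.
pose c y := [arg min_(y' < y0 | D y') hamming y y'].
have cP y : D (c y) /\ forall y', D y' -> (hamming y (c y) <= hamming y y')%N.
  by rewrite /c; case: arg_minnP.
pose f y : R := (hamming y (c y))%:R.
have fL y y' : f y - f y' <= (hamming y y')%:R.
  rewrite lerBlDr -natrD ler_nat; have [Dc _] := cP y'; have [_ h] := cP y.
  exact: leq_trans (h _ Dc) (hamming_triangle _ _ _).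
have fD y : D y -> f y = 0.
  move=> Dy; apply/eqP; rewrite pnatr_eq0 -leqn0.
  by have [_ /(_ y Dy)] := cP y; rewrite hammingxx.
have := lipschitz_variance p f hp fL; rewrite -/mu.
set E := \sum_y mu y * f y => var.
have n0 : 0 < n%:R :> R.
  rewrite lt_def ler0n andbT; apply/eqP => n0; move: nth.
  by rewrite n0 mulr0; lra.
have E0 : 0 <= E by apply: sumr_ge0 => y _; rewrite mulr_ge0.
have thE : theta * E ^+ 2 <= n%:R.
  apply: le_trans var; apply: (@le_trans _ _ ((\sum_(y | D y) mu y) * E ^+ 2)).
    by rewrite ler_wpM2r // sqr_ge0.
  rewrite mulr_suml [leRHS](bigID D) /= -[leLHS]addr0 lerD //.
    by apply: ler_sum => y Dy; rewrite fD // sub0r sqrrN.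
  by apply: sumr_ge0 => y _; rewrite mulr_ge0 // sqr_ge0.
(* Half of the radius absorbs the mean; the other half is the deviation in Chebyshev's
   inequality. *)
set h := kappa * n%:R / 2; have h0 : 0 < h by rewrite divr_gt0 ?mulr_gt0.
have h2 (t : R) : t * h ^+ 2 = t * kappa ^+ 2 * n%:R * n%:R / 4 by rewrite /h; field.
have Eh : E <= h.
  rewrite -(@ler_pXn2r _ 2) ?nnegrE ?(ltW h0) //.
  rewrite -(@ler_pM2l _ theta) // (le_trans thE) //.
  have : 4 * n%:R <= theta * kappa ^+ 2 * n%:R * n%:R by rewrite ler_pM2r.
  by rewrite h2; lra.
have hE y : ~~ near_set kappa D y -> h <= f y - E.
  move=> /existsPn /(_ (c y)); rewrite (proj1 (cP y)) /= -ltNge => hy.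
  have : h + h < f y by apply: le_lt_trans hy; rewrite /h; lra.
  lra.
have hh0 : 0 < h ^+ 2 by rewrite exprn_gt0.
rewrite -(ler_pM2r hh0) mulr_suml.
apply: (@le_trans _ _ n%:R).
  apply: le_trans var; rewrite [leRHS](bigID (near_set kappa D)) /=.
  rewrite -[leLHS]add0r lerD //.
    by apply: sumr_ge0 => y _; rewrite mulr_ge0 // sqr_ge0.
  apply: ler_sum => y hy; rewrite ler_wpM2l // lerXn2r ?nnegrE ?hE ?(ltW h0) //.
  by apply: le_trans (hE _ hy); exact: ltW.
have : 4 * n%:R <= tau * kappa ^+ 2 * n%:R * n%:R by rewrite ler_pM2r.
by rewrite h2; lra.
Qed.

(** Chernoff counting: the indicator of the ball is at most an exponential of the slack, whose sum
    factorises over the letters, each factor being at most 1 + #|B| exp (- a). Taking [a] large and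
    then [kappa] small makes the exponent a small multiple of [n]. *)
Lemma card_ball_le {n} (y : {ffun 'I_n -> B}) (kappa a : R) : 0 <= a ->
  #|[set y' | (hamming y y')%:R <= kappa * n%:R]|%:R <=
  expR (n%:R * (kappa * a + #|B|%:R * expR (- a))).
Proof.
move=> a0.
rewrite -sum1_card natr_sum.
apply: (@le_trans _ _ (\sum_y' expR (a * (kappa * n%:R - (hamming y y')%:R)))).
  rewrite [leRHS](bigID (mem [set y' | (hamming y y')%:R <= kappa * n%:R])) /=.
  rewrite -[leLHS]addr0 lerD ?sumr_ge0 //.
  apply: ler_sum => y'; rewrite inE => h.
  by rewrite -[leLHS]expR0 ler_expR mulr_ge0 // subr_ge0.
have -> : \sum_y' expR (a * (kappa * n%:R - (hamming y y')%:R)) =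
    expR (a * (kappa * n%:R)) * \prod_(i < n) \sum_v expR (- a * (y i != v)%:R).
  rewrite bigA_distr_bigA mulr_sumr; apply: eq_bigr => y' _.
  rewrite -expR_sum -expRD; congr expR.
  by rewrite -mulr_sumr /hamming natr_sum; ring.
have -> : n%:R * (kappa * a + #|B|%:R * expR (- a)) =
    a * (kappa * n%:R) + \sum_(i < n) #|B|%:R * expR (- a).
  by rewrite sumr_const card_ord -mulr_natl; ring.
rewrite expRD ler_wpM2l ?expR_ge0 // expR_sum.
apply: ler_prod => i _; rewrite sumr_ge0 => [|v _]; last exact: expR_ge0.
apply: le_trans (expR_ge1Dx _).
rewrite (bigD1 (y i)) //= eqxx mulr0 expR0 lerD2l.
apply: (@le_trans _ _ (\sum_(v : B) expR (- a))).
  rewrite [leRHS](bigD1 (y i)) //= -[leLHS]add0r lerD ?expR_ge0 //.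
  by apply: ler_sum => v; rewrite eq_sym => ->; rewrite mulr1.
by rewrite sumr_const mulr_natl.
Qed.

End BlowingUp.

(** * Error and leakage through output laws, and the selection of good messages *)

Section Codes.
Context {R : realType} {X Y Z : finType} (W : X -> Y -> Z -> R).
Hypothesis hW : is_channel W.

Local Notation Pc := (Pc R X Y Z W).
Local Notation Pe := (Pe R X Y Z W).
Local Notation mutinfo := (mutinfoMZ R X Y Z W).
Local Notation code := (Defs.code R X Y).
Local Notation enc c := (enc R X Y _ c).
Local Notation dec c := (dec R X Y _ c).
Local Notation msize c := (msize R X Y _ c).

(** The two marginal channels: the error probability depends on [W] through [legit], the leakage
    through [tapped]. *)
Definition legit (x : X) (y : Y) : R := \sum_z W x y z.
Definition tapped (x : X) (z : Z) : R := \sum_y W x y z.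

Lemma legit_stochastic : stochastic legit.
Proof.
have [W0 W1] := hW.
by move=> x; split=> [y|]; [apply: sumr_ge0 => z _; exact: W0|exact: W1].
Qed.

Lemma tapped_stochastic : stochastic tapped.
Proof.
have [W0 W1] := hW.
move=> x; split=> [z|]; first by apply: sumr_ge0 => y _; exact: W0.
by rewrite exchange_big; exact: W1.
Qed.

Lemma chanN_legit {n} (x : {ffun 'I_n -> X}) y :
  \sum_z chanN R X Y Z W x y z = prod_law (fun t => legit (x t)) y.
Proof. by rewrite /prod_law /legit bigA_distr_bigA. Qed.

Lemma chanN_tapped {n} (x : {ffun 'I_n -> X}) z :
  \sum_y chanN R X Y Z W x y z = prod_law (fun t => tapped (x t)) z.
Proof. by rewrite /prod_law /tapped bigA_distr_bigA. Qed.

Lemma enc_pmf {n} (c : code n) m : is_pmf (enc c m).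
Proof. by split; [exact: enc_ge0|exact: enc_sum1]. Qed.

Lemma Pc_out {n} (c : code n) : Pc c =
  (msize c)%:R^-1 * \sum_m \sum_(y | dec c y == m) out legit (enc c m) y.
Proof.
rewrite /Defs.Pc mulr_sumr; apply: eq_bigr => m _.
rewrite exchange_big mulr_sumr big_mkcond [RHS]big_mkcond /=; apply: eq_bigr => y _.
rewrite mulr_sumr; case: ifP => _; last by rewrite big1 // => x _; rewrite big1.
by apply: eq_bigr => x _; rewrite -chanN_legit mulr_sumr mulr_sumr;
  apply: eq_bigr => z _; rewrite /pjoint mulrA.
Qed.

Definition tap_law {n} (c : code n) (m : 'I_(msize c)) := out tapped (enc c m).
Arguments tap_law {n}.

(** As the message is uniform, the mixture is the law of Z^n. In this form the leakage can be
    compared with other reference laws. *)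
Lemma mutinfo_kl {n} (c : code n) : mutinfo c =
  (msize c)%:R^-1 * \sum_m kl (tap_law c m) (mixture (tap_law c)).
Proof.
have M0 : 0 < (msize c)%:R^-1 :> R.
  by rewrite invr_gt0 ltr0n; exact: msize_gt0.
have pMZE m z : pMZ R X Y Z W c m z = (msize c)%:R^-1 * tap_law c m z.
  rewrite /pMZ /tap_law /out mulr_sumr; apply: eq_bigr => x _.
  by rewrite -chanN_tapped !mulr_sumr; apply: eq_bigr => y _; rewrite /pjoint mulrA.
have pZE z : pZ R X Y Z W c z = mixture (tap_law c) z.
  by rewrite /pZ /mixture card_ord mulr_sumr; apply: eq_bigr => m _.
rewrite /mutinfoMZ mulr_sumr; apply: eq_bigr => m _.
rewrite mulr_sumr; apply: eq_bigr => z _; rewrite pMZE pZE /pM.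
case: eqP => [/eqP|_].
  by rewrite mulf_eq0 (gt_eqF M0) => /eqP ->; rewrite mul0r mulr0.
rewrite [RHS]mulrA; congr (_ * ln _).
by rewrite -mulf_div divff ?mul1r // gt_eqF.
Qed.

Lemma tap_law_pmf {n} (c : code n) m : is_pmf (tap_law c m).
Proof. exact: pmf_out tapped_stochastic (enc_pmf c m). Qed.

(** The mixture minimises the mean divergence, so any convenient [q] bounds the leakage; for the
    outer code it will be a product over blocks. *)
Lemma mutinfo_bounds {n} (c : code n) (q : {ffun 'I_n -> Z} -> R) :
    is_pmf q -> (forall m, dominated (tap_law c m) q) ->
  0 <= mutinfo c <= (msize c)%:R^-1 * \sum_m kl (tap_law c m) q.
Proof.
move=> hq cq; rewrite mutinfo_kl.
have M0 : 0 < (msize c)%:R^-1 :> R.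
  by rewrite invr_gt0 ltr0n; exact: msize_gt0.
have := @kl_mixture _ _ _ (tap_law c) q; rewrite card_ord.
move=> /(_ (msize_gt0 _ _ _ _ c) (tap_law_pmf c) hq cq) /andP[h1 h2].
by rewrite mulr_ge0 ?(ltW M0) //= ler_pM2l.
Qed.

Lemma mutinfo_ge0 {n} (c : code n) : 0 <= mutinfo c.
Proof.
have M0 : (0 < #|'I_(msize c)|)%N by rewrite card_ord; exact: msize_gt0.
have /andP[] // := mutinfo_bounds c (mixture (tap_law c))
  (mixture_pmf _ M0 (tap_law_pmf c))
  (fun m => dominated_mixture _ m M0 (tap_law_pmf c)).
Qed.

(* Conditioning (M, X^n) on the event that the word sent is decoded correctly
   with probability at least eta / 2 costs only constants, both in the number
   of messages and in the leakage, and it makes the blowing-up lemma apply to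
   every remaining word. *)
Lemma good_messages {n} (c : code n) (eta kappa tau : R) :
    0 < eta -> eta <= Pc c -> 0 < kappa -> 0 < tau ->
    4 <= eta / 2 * kappa ^+ 2 * n%:R -> 4 <= tau * kappa ^+ 2 * n%:R ->
  let b := 8 / eta in let q := mixture (tap_law c) in
  exists (S : {set 'I_(msize c)}) (e : 'I_(msize c) -> {ffun 'I_n -> X} -> R),
    (msize c)%:R * (eta / 8) <= #|S|%:R /\
    forall m, m \in S -> [/\ is_pmf (e m), dominated (out tapped (e m)) q,
      kl (out tapped (e m)) q <= ln b + b * (4 / eta * (mutinfo c + 1) + 1) &
      \sum_(y | ~~ near_set kappa (fun y => dec c y == m) y) out legit (e m) y <= tau].
Proof.
move=> eta0 Pceta ka0 ta0 n1 n2 b q.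
set I := mutinfo c; have I0 : 0 <= I by exact: mutinfo_ge0.
have M0 : 0 < (msize c)%:R :> R by rewrite ltr0n; exact: msize_gt0.
have M0' : (0 < #|'I_(msize c)|)%N by rewrite card_ord; exact: msize_gt0.
have hq : is_pmf q := mixture_pmf _ M0' (tap_law_pmf c).
have dq m : dominated (tap_law c m) q := dominated_mixture _ m M0' (tap_law_pmf c).
have b0 : 0 < b by rewrite divr_gt0.
pose mu (x : {ffun 'I_n -> X}) := prod_law (fun t => legit (x t)) : {ffun 'I_n -> Y} -> R.
have hmu x : is_pmf (mu x) by apply: pmf_prod => t; exact: legit_stochastic.
pose a m x := \sum_(y | dec c y == m) mu x y.
have a1 m x : a m x <= 1.
  rewrite -(proj2 (hmu x)) [leRHS](bigID (fun y => dec c y == m)) /= lerDl.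
  by apply: sumr_ge0 => y _; case: (hmu x).
pose good m x := eta / 2 <= a m x.
pose g m := \sum_(x | good m x) enc c m x.
have e0 m x : 0 <= enc c m x by case: (enc_pmf c m).
have e1 m : \sum_x enc c m x = 1 by case: (enc_pmf c m).
have g1 m : g m <= 1.
  by rewrite -(e1 m) [leRHS](bigID (good m)) /= lerDl sumr_ge0.
(* Words that are not good contribute at most [eta / 2] to the success probability, so the good ones
   carry the remaining [eta / 2]. *)
have gP : (msize c)%:R * (eta / 2) <= \sum_m g m.
  have : (msize c)%:R * eta <= \sum_m (g m + eta / 2).
    have := Pceta; rewrite Pc_out -(ler_pM2l M0) mulrA divff ?gt_eqF // mul1r.
    move=> h; apply: (le_trans h); apply: ler_sum => m _.
    have -> : \sum_(y | dec c y == m) out legit (enc c m) y = \sum_x enc c m x * a m x.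
      by rewrite exchange_big /=; apply: eq_bigr => x _; rewrite -mulr_sumr.
    rewrite (bigID (good m)) /= lerD //.
      by apply: ler_sum => x _; rewrite ler_piMr.
    apply: (@le_trans _ _ (\sum_x enc c m x * (eta / 2))).
      rewrite [leRHS](bigID (good m)) /= -[leLHS]add0r lerD //.
        by apply: sumr_ge0 => x _; rewrite mulr_ge0 // ltW // divr_gt0.
      by apply: ler_sum => x; rewrite /good -ltNge => hx; rewrite ler_wpM2l // ltW.
    by rewrite -mulr_suml e1 mul1r.
  by rewrite big_split /= sumr_const card_ord -[_ *+ msize c]mulr_natl; lra.
pose d m := kl (tap_law c m) q.
have d0 m : 0 <= d m by apply: kl_ge0 => //; exact: tap_law_pmf.
have dI : \sum_m d m = (msize c)%:R * I.
  by rewrite /I mutinfo_kl mulrA divff ?mul1r // gt_eqF.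
(* A single averaging of [h] makes [g m] large and [d m] small at once. *)
pose h m := g m - eta / 4 * (d m / (I + 1)).
have I10 : 0 < I + 1 by lra.
have et4 : 0 < eta / 4 by rewrite divr_gt0.
have dd m : 0 <= d m / (I + 1) by rewrite divr_ge0 // ltW.
have h1 m : h m <= 1.
  by have := g1 m; have := mulr_ge0 (ltW et4) (dd m); rewrite /h; lra.
(* The [g m] have mean at least [eta / 2]. The penalties have mean at most [eta / 4], since I / (I +
   1) <= 1; the [+ 1] keeps the denominator positive. *)
have hsum : #|'I_(msize c)|%:R * (2 * (eta / 8)) <= \sum_m h m.
  rewrite card_ord sumrB -mulr_sumr -mulr_suml dI.
  have : (msize c)%:R * I / (I + 1) <= (msize c)%:R.
    by rewrite ler_pdivrMr // ler_pM2l //; lra.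
  by rewrite -(ler_pM2l et4); lra.
have et8 : 0 < eta / 8 by rewrite divr_gt0.
have cS := card_ge_mean h (eta / 8) h1 (ltW et8) hsum.
pose e m x := if good m x then enc c m x / g m else 0.
exists [set m | eta / 8 <= h m], e; split; first by rewrite card_ord in cS.
move=> m; rewrite inE => hm.
have gm : eta / 8 <= g m.
  by have := mulr_ge0 (ltW et4) (dd m); rewrite /h in hm; lra.
have gm0 : 0 < g m by lra.
have dm : d m <= 4 / eta * (I + 1).
  have : eta / 4 * (d m / (I + 1)) <= 1 by have := g1 m; rewrite /h in hm; lra.
  rewrite mulrA ler_pdivrMr // mul1r => h2; rewrite -(ler_pM2l et4) (le_trans h2) //.
  by rewrite mulrA (_ : eta / 4 * (4 / eta) = 1) ?mul1r //; field; lra.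
(* Conditioning divides by [g m >= eta / 8], whence the factor [b]. *)
have eb x : e m x <= b * enc c m x.
  rewrite /e; case: ifP => _; last by rewrite mulr_ge0 // ltW.
  rewrite mulrC ler_wpM2r // /b -[8 / eta]invf_div lef_pV2 ?posrE //.
have epmf : is_pmf (e m).
  split=> [x|]; first by rewrite /e; case: ifP => // _; rewrite divr_ge0 // ltW.
  by rewrite -big_mkcond /= -mulr_suml divff ?gt_eqF.
have outb z : out tapped (e m) z <= b * tap_law c m z.
  by apply: out_le => //; exact: tapped_stochastic.
have outpmf := pmf_out tapped_stochastic epmf.
split=> //.
- move=> z /dq tz; apply/eqP; rewrite eq_le (proj1 outpmf) andbT.
  by have := outb z; rewrite tz mulr0.
- apply: le_trans (kl_le_scaled b _ (tap_law c m) q b0 outpmf (tap_law_pmf c m) hq (dq m) outb) _.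
  by rewrite lerD2l ler_pM2l // lerD2r.
(* [blowing_up] needs a product law, so it is applied to each word of positive weight separately and
   then averaged; this is why single words had to be good. *)
- rewrite exchange_big /=.
  rewrite -[leRHS]mul1r -(proj2 epmf) mulr_suml; apply: ler_sum => x _.
  rewrite -mulr_sumr; have [->|ex] := eqVneq (e m x) 0; first by rewrite !mul0r.
  rewrite ler_wpM2l //; first by case: epmf.
  apply: (@blowing_up _ _ _ _ _ (eta / 2)) => //; first by move=> t; exact: legit_stochastic.
    by rewrite divr_gt0.
  by move: ex; rewrite /e /good; case: ifP => //; rewrite eqxx.
Qed.

End Codes.

(** * Greedy choice of an outer codebook *)

Section GreedyCodebook.
Context {R : realType} {C T : finType} (V : C -> T -> R) (pass : C -> pred T).

(* The decoder returns the first codeword that passes. New codewords are put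
   in front, so that a new one hurts only through the outputs of the older
   ones which it captures; averaged over the new codeword this is controlled
   by [beta], whatever its own output law is. *)
Lemma greedy_codebook (rho beta : R) (K : nat) :
    (0 < #|C|)%N -> (forall c, is_pmf (V c)) ->
    (forall c, \sum_(y | ~~ pass c y) V c y <= rho) ->
    (forall y, #|[set c | pass c y]|%:R <= beta * #|C|%:R) ->
  exists (w : 'I_K.+1 -> C) (dec : T -> 'I_K.+1),
    \sum_i \sum_(y | dec y != i) V (w i) y <= K.+1%:R * (rho + K%:R * beta).
Proof.
move=> C0 hV hrho hbeta.
have [c0 _] := card_gt0P C0.
have V0 c y : 0 <= V c y by case: (hV c).
have b0 : 0 <= beta.
  have [y] : exists y : T, True.
    apply: contrapT => h; have := proj2 (hV c0); rewrite big1 => [|y]; last by case: h; exists y.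
    by move/eqP; rewrite eq_sym oner_eq0.
  have C0' : 0 < #|C|%:R :> R by rewrite ltr0n C0.
  by move=> _; rewrite -(pmulr_lge0 _ C0'); exact: le_trans (ler0n _ _) (hbeta y).
pose first (s : seq C) y := find (fun c => pass c y) s.
suff [s [szs hs]] : exists s, size s = K.+1 /\
    \sum_(i < size s) \sum_(y | first s y != i) V (nth c0 s i) y <=
    (size s)%:R * (rho + K%:R * beta).
  (* [find] gives [K.+1] when nothing passes. Whatever [inord] then returns, such a [y] is already
     counted as an error for every codeword. *)
  exists (fun i => nth c0 s i), (fun y => inord (first s y)).
  rewrite szs in hs; apply: le_trans hs; apply: ler_sum => i _.
  rewrite big_mkcond [leRHS]big_mkcond; apply: ler_sum => y _ /=.
  have [->|_] := eqVneq (first s y) i; last by case: ifP => _ /=; rewrite ?lexx ?V0.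
  by rewrite inord_val eqxx.
suff H k : (k <= K.+1)%N -> exists s, size s = k /\
    \sum_(i < size s) \sum_(y | first s y != i) V (nth c0 s i) y <=
    (size s)%:R * (rho + K%:R * beta) by exact: H.
elim: k => [_|k IH kK]; first by exists [::]; rewrite big_ord0 mul0r.
have [s [szs hs]] := IH (ltnW kK).
pose cap c := \sum_(i < size s) \sum_(y | pass c y) V (nth c0 s i) y.
(* By averaging: each output passes for at most a fraction [beta] of the words, and [s] has at most
   [K] entries. *)
have [c hc] : exists c, cap c <= K%:R * beta.
  apply: contrapT => /forallNP h.
  have : \sum_c cap c <= #|C|%:R * (K%:R * beta).
    rewrite exchange_big /=; apply: (@le_trans _ _ (\sum_(i < size s) beta * #|C|%:R)).
      apply: ler_sum => i _; under eq_bigr do rewrite big_mkcond.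
      rewrite exchange_big /=.
      apply: (@le_trans _ _ (\sum_y beta * #|C|%:R * V (nth c0 s i) y)); last first.
        by rewrite -mulr_sumr (proj2 (hV _)) mulr1.
      apply: ler_sum => y _; rewrite -big_mkcond /= sumr_const.
      rewrite -[leLHS]mulr_natl ler_wpM2r //.
      by apply: le_trans (hbeta y); rewrite cardsE.
    rewrite sumr_const card_ord -[leLHS]mulr_natl mulrCA [beta * _]mulrC.
    by rewrite !mulrA ler_wpM2r // [leRHS]mulrC ler_wpM2r // ler_nat szs -ltnS.
  apply/negP; rewrite -ltNge mulr_natl -sumr_const.
  apply: ltr_sum; first by apply/hasP; exists c0; rewrite ?mem_index_enum.
  by move=> c _; rewrite ltNge; apply/negP; exact: h.
exists (c :: s); split; first by rewrite /= szs.
rewrite [size _]/= big_ord_recl -natr1 mulrDl mul1r addrC.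
have -> : \sum_(y | first (c :: s) y != ord0 :> nat) V (nth c0 (c :: s) ord0) y =
    \sum_(y | ~~ pass c y) V c y.
  by move=> ? ?; apply: eq_big => [y|//]; rewrite /first /=; case: (pass c y).
apply: (@le_trans _ _ ((\sum_(i < size s) \sum_(y | first s y != i) V (nth c0 s i) y +
    cap c) + \sum_(y | ~~ pass c y) V c y)); last first.
  by rewrite -addrA lerD // addrC lerD.
rewrite lerD2r -big_split /=; apply: ler_sum => i _.
rewrite big_mkcond [X in _ <= X + _]big_mkcond [X in _ <= _ + X]big_mkcond -big_split /=.
apply: ler_sum => y _; rewrite /bump /= add1n /first /=.
(* If the new codeword passes, it takes the output from all older ones, which [cap c] pays for;
   otherwise the indices just shift by one. *)
case: (pass c y); rewrite /= ?eqSS; last by rewrite addr0.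
by case: ifP; rewrite ?lerDl ?add0r ?V0.
Qed.

End GreedyCodebook.

(** * Words of inner blocks: leakage, missed blocks and the count of passing words *)

Section BlockCode.
Context {R : realType} {X U : finType} (n r : nat) (x0 : X).
Variable e : U -> {ffun 'I_n -> X} -> R.

(* [k] inner blocks of length [n] followed by [r] copies of the letter [x0]. *)
Fixpoint block_length (k : nat) : nat :=
  if k is k'.+1 then (n + block_length k')%N else r.

Lemma block_lengthE k : block_length k = (k * n + r)%N.
Proof. by elim: k => //= k ->; rewrite mulSn addnA. Qed.

Fixpoint words (k : nat) : finType :=
  if k is k'.+1 then (U * words k')%type else unit.

Lemma card_words k : #|words k| = (#|U| ^ k)%N.
Proof. by elim: k => [|k IH] /=; rewrite ?card_unit // card_prod IH expnS. Qed.

Definition point_law {m} (x : {ffun 'I_m -> X}) : R := (x == [ffun=> x0])%:R.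

Lemma point_pmf m : is_pmf (@point_law m).
Proof.
split=> [x|]; first exact: ler0n.
rewrite (bigD1 [ffun=> x0]) //= /point_law eqxx big1 ?addr0 // => x.
by move/negbTE->.
Qed.

(** The recursion follows that of [block_length], so that the first block and the rest are [lpart]
    and [rpart] without casts. *)
Fixpoint word_law (k : nat) : words k -> {ffun 'I_(block_length k) -> X} -> R :=
  match k return words k -> {ffun 'I_(block_length k) -> X} -> R with
  | 0 => fun _ => point_law
  | k'.+1 => fun c => cat_law (e c.1) (word_law k' c.2)
  end.

(** Reference law common to all codewords: independent blocks of law [q], then the output of the
    padding, which contributes no divergence. *)
Fixpoint ref_law {B : finType} (V : X -> B -> R) (q : {ffun 'I_n -> B} -> R) (k : nat) :
    {ffun 'I_(block_length k) -> B} -> R :=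
  match k return {ffun 'I_(block_length k) -> B} -> R with
  | 0 => out V point_law
  | k'.+1 => cat_law q (ref_law V q k')
  end.

(** [L y u] means that [u] lies in the list decoded from the block [y]; the blocks whose letter is
    not listed are counted. *)
Fixpoint misses {B : finType} (L : {ffun 'I_n -> B} -> pred U) (k : nat) :
    words k -> {ffun 'I_(block_length k) -> B} -> nat :=
  match k return words k -> {ffun 'I_(block_length k) -> B} -> nat with
  | 0 => fun _ _ => 0%N
  | k'.+1 => fun c y => (~~ L (lpart y) c.1 + misses L k' c.2 (rpart y))%N
  end.

Hypothesis he : forall u, is_pmf (e u).

Lemma word_law_pmf k (c : words k) : is_pmf (word_law k c).
Proof.
elim: k c => [|k IH] c /=; first exact: point_pmf.
exact: pmf_cat.
Qed.

Lemma out_cat_fun {B : finType} (V : X -> B -> R) {m m'}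
    (p : {ffun 'I_m -> X} -> R) (p' : {ffun 'I_m' -> X} -> R) :
  out V (cat_law p p') = cat_law (out V p) (out V p').
Proof. by apply/funext => b; exact: out_cat. Qed.

Lemma kl_word_law {B : finType} (V : X -> B -> R) (q : {ffun 'I_n -> B} -> R) Delta k c :
    stochastic V -> is_pmf q -> (forall u, dominated (out V (e u)) q) ->
    (forall u, kl (out V (e u)) q <= Delta) ->
  [/\ is_pmf (ref_law V q k), dominated (out V (word_law k c)) (ref_law V q k) &
      kl (out V (word_law k c)) (ref_law V q k) <= k%:R * Delta].
Proof.
move=> hV hq dq kq; elim: k c => [|k IH] c /=.
  split; [exact: pmf_out (point_pmf _)|by []|by rewrite kl_self mul0r].
have [h1 h2 h3] := IH c.2; rewrite out_cat_fun; split.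
- exact: pmf_cat.
- exact: dominated_cat.
- have oe := pmf_out hV (he c.1); have ow := pmf_out hV (word_law_pmf k c.2).
  by rewrite kl_cat // -natr1 mulrDl mul1r addrC lerD.
Qed.

Context {Y : finType} (V : X -> Y -> R) (hV : stochastic V).
Variable L : {ffun 'I_n -> Y} -> pred U.

(** Given the codeword the blocks are independent, so the moment factorises. A block contributes 1
    if its letter is listed and [a], with probability at most [tau], if not. *)
Lemma misses_mgf (a tau : R) k c : 0 <= a ->
    (forall u, \sum_(y | ~~ L y u) out V (e u) y <= tau) ->
  \sum_y out V (word_law k c) y * a ^+ misses L k c y <= (1 + a * tau) ^+ k.
Proof.
move=> a0 hL; elim: k c => [|k IH] c /=.
  under eq_bigr do rewrite expr0 mulr1.
  by rewrite expr0 (proj2 (pmf_out hV (point_pmf r))).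
rewrite out_cat_fun; under eq_bigr do rewrite exprD.
rewrite (sum_cat_law _ _ (fun y => a ^+ ~~ L y c.1) (fun y => a ^+ misses L k c.2 y)).
rewrite exprS; have [out0 out1] := pmf_out hV (he c.1).
apply: ler_pM => //.
- by apply: sumr_ge0 => y _; rewrite mulr_ge0 ?exprn_ge0.
- apply: sumr_ge0 => y _; rewrite mulr_ge0 ?exprn_ge0 //.
  by case: (pmf_out hV (word_law_pmf k c.2)).
rewrite (bigID (fun y => L y c.1)) /=; apply: lerD.
  rewrite -out1 [leRHS](bigID (fun y => L y c.1)) /= -[leLHS]addr0 lerD ?sumr_ge0 //.
  by apply: ler_sum => y ->; rewrite expr0 mulr1.
apply: (@le_trans _ _ (a * \sum_(y | ~~ L y c.1) out V (e c.1) y)); last by rewrite ler_wpM2l.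
by rewrite mulr_sumr; apply: ler_sum => y ->; rewrite expr1 mulrC.
Qed.

(** Tolerating a fraction 1 / j of missed blocks makes failure exponentially rare in [k], for a rate
    loss of the same fraction. *)
Definition passes (j k : nat) (c : words k) y := (misses L k c y * j < k)%N.

(* Markov's inequality for [(4 ^ j) ^ misses], whose mean is at most [2 ^ k]. *)
Lemma passes_prob (j k : nat) c :
    (forall u, \sum_(y | ~~ L y u) out V (e u) y <= (4 ^- j)) ->
  \sum_(y | ~~ passes j k c y) out V (word_law k c) y <= 2 ^- k.
Proof.
move=> hL; have a0 : 0 < 4 ^+ j :> R by rewrite exprn_gt0.
have := misses_mgf (4 ^+ j) (4 ^- j) k c (ltW a0) hL.
rewrite divff ?gt_eqF // (_ : 1 + 1 = 2) // => h.
have k4 : 0 < 4 ^+ k :> R by rewrite exprn_gt0.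
rewrite -(ler_pM2r k4) (_ : 2 ^- k * 4 ^+ k = 2 ^+ k); last first.
  rewrite (_ : 4 = 2 * 2) ?exprMn ?mulKf ?expf_neq0 //; lra.
apply: le_trans h; rewrite mulr_suml [leRHS](bigID (passes j k c)) /=.
have [out0 out1] := pmf_out hV (word_law_pmf k c).
rewrite -[leLHS]add0r lerD ?sumr_ge0 // => [y _|]; first by rewrite mulr_ge0 ?exprn_ge0 ?(ltW a0).
apply: ler_sum => y; rewrite /passes -leqNgt => hk; rewrite ler_wpM2l //.
by rewrite -exprM; apply: ler_weXn2l; [lra|rewrite mulnC].
Qed.

(** The weights factorise over blocks: listed letters contribute at most [Lam] in all, the others at
    most [#|U|] times the inverse of [#|U|], that is 1. *)
Lemma misses_count (Lam : R) k y : (0 < #|U|)%N -> 0 <= Lam ->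
    (forall y, #|[set u | L y u]|%:R <= Lam) ->
  \sum_c (#|U|%:R ^- misses L k c y) <= (Lam + 1) ^+ k :> R.
Proof.
move=> U0 Lam0 hL; have U0' : 0 < #|U|%:R :> R by rewrite ltr0n.
elim: k y => [|k IH] y /=.
  by rewrite sumr_const card_unit expr0 invr1.
rewrite -(pair_bigA _ (fun u c => #|U|%:R ^- (~~ L (lpart y) u + misses L k c (rpart y)))) /=.
under eq_bigr do under eq_bigr do rewrite exprD invfM.
under eq_bigr do rewrite -mulr_sumr.
rewrite -mulr_suml exprS; apply: ler_pM => //.
- by apply: sumr_ge0 => u _; rewrite invr_ge0 exprn_ge0.
- by apply: sumr_ge0 => u _; rewrite invr_ge0 exprn_ge0.
rewrite (bigID (L (lpart y))) /=; apply: lerD.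
  apply: le_trans (hL (lpart y)); rewrite -sum1dep_card natr_sum.
  by apply: ler_sum => u ->; rewrite expr0 invr1.
apply: (@le_trans _ _ (\sum_(u : U) #|U|%:R^-1)).
  rewrite [leRHS](bigID (L (lpart y))) /= -[leLHS]add0r lerD ?sumr_ge0 //.
  by apply: ler_sum => u ->; rewrite expr1.
by rewrite sumr_const -[leLHS]mulr_natl divff // gt_eqF.
Qed.

(** A passing word misses at most [k %/ j] blocks, which bounds its weight in [misses_count] from
    below. *)
Lemma passes_count (Lam : R) (j k : nat) y : (0 < #|U|)%N -> 0 <= Lam -> (0 < j)%N ->
    (forall y, #|[set u | L y u]|%:R <= Lam) ->
  #|[set c | passes j k c y]|%:R <= (Lam + 1) ^+ k * #|U|%:R ^+ (k %/ j).
Proof.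
move=> U0 Lam0 j0 hL; have U0' : 0 < #|U|%:R :> R by rewrite ltr0n.
have kj : 0 < #|U|%:R ^+ (k %/ j) :> R by rewrite exprn_gt0.
apply: le_trans (ler_wpM2r (ltW kj) (misses_count Lam k y U0 Lam0 hL)).
rewrite -sum1dep_card natr_sum mulr_suml.
rewrite [leRHS](bigID (fun c => passes j k c y)) /= -[leLHS]addr0 lerD //.
  apply: ler_sum => c hc; rewrite mulrC ler_pdivlMr ?exprn_gt0 // mul1r.
  by apply: ler_weXn2l; rewrite ?ler1n // leq_divRL //; exact: ltnW hc.
by apply: sumr_ge0 => c _; rewrite mulr_ge0 ?invr_ge0 ?exprn_ge0.
Qed.

End BlockCode.

(** * From one inner code to a code with small error *)

Section OuterCode.
Context {R : realType} {X Y Z : finType} (W : X -> Y -> Z -> R).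
Hypothesis hW : is_channel W.

Local Notation Pc := (Pc R X Y Z W).
Local Notation Pe := (Pe R X Y Z W).
Local Notation mutinfo := (mutinfoMZ R X Y Z W).
Local Notation code := (Defs.code R X Y).
Local Notation dec c := (dec R X Y _ c).
Local Notation msize c := (msize R X Y _ c).

(** The condition on [K] says that [K] times the fraction of words passing for a given output is at
    most [2 ^- k]. The greedy codebook then errs with probability at most twice [2 ^- k], and its
    leakage is bounded whatever the codebook. *)
Lemma outer_code {U : finType} (n r : nat) (x0 : X)
    (e : U -> {ffun 'I_n -> X} -> R) (q : {ffun 'I_n -> Z} -> R)
    (L : {ffun 'I_n -> Y} -> pred U) (Delta Lam : R) (j k K : nat) :
    (0 < #|U|)%N -> (0 < j)%N -> 0 <= Lam ->
    (forall u, is_pmf (e u)) -> is_pmf q ->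
    (forall u, dominated (out (tapped W) (e u)) q) ->
    (forall u, kl (out (tapped W) (e u)) q <= Delta) ->
    (forall u, \sum_(y | ~~ L y u) out (legit W) (e u) y <= 4 ^- j) ->
    (forall y, #|[set u | L y u]|%:R <= Lam) ->
    K%:R * ((Lam + 1) ^+ k * #|U|%:R ^+ (k %/ j)) * 2 ^+ k <= #|U|%:R ^+ k ->
  exists c : code (block_length n r k), [/\ msize c = K.+1,
    Pe c <= 2 * 2 ^- k & 0 <= mutinfo c <= k%:R * Delta].
Proof.
move=> U0 j0 Lam0 he hq dq kq hL cL hK.
have lW := legit_stochastic W hW; have tW := tapped_stochastic W hW.
pose V (w : words (U:=U) k) := out (legit W) (word_law n r x0 e k w).
have hV w : is_pmf (V w) by apply: pmf_out => //; exact: word_law_pmf.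
have U0' : 0 < #|U|%:R :> R by rewrite ltr0n.
have Uk0 : 0 < #|U|%:R ^+ k :> R by rewrite exprn_gt0.
pose beta : R := (Lam + 1) ^+ k * #|U|%:R ^+ (k %/ j) / #|U|%:R ^+ k.
have cardW : #|words (U:=U) k|%:R = #|U|%:R ^+ k :> R by rewrite card_words natrX.
have [|w|y|w [dec hdec]] := greedy_codebook V (passes n r L j k) (2 ^- k) beta K _ hV.
- by rewrite card_words expn_gt0 U0.
- exact: passes_prob.
- by rewrite cardW divfK ?gt_eqF //; exact: passes_count.
have wpmf i := word_law_pmf n r x0 e he k (w i).
pose c : code (block_length n r k) := Code R X Y _ K.+1 isT
  (fun i => word_law n r x0 e k (w i)) (fun i => proj1 (wpmf i))
  (fun i => proj2 (wpmf i)) dec.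
exists c; split=> //.
- have K0 : 0 < K.+1%:R :> R by rewrite ltr0n.
  rewrite /Defs.Pe Pc_out /= -(ler_pM2l K0) mulrBr mulr1 mulrA divff ?gt_eqF // mul1r.
  have KE : K.+1%:R = \sum_(i < K.+1) \sum_y V (w i) y.
    rewrite (eq_bigr (fun=> 1)) => [|i _]; last by case: (hV (w i)).
    by rewrite sumr_const card_ord.
  rewrite [X in X - _]KE -sumrB; apply: (@le_trans _ _ (\sum_i \sum_(y | dec y != i) V (w i) y)).
    apply: ler_sum => i _; rewrite (bigID (fun y => dec y == i)) /=.
    by rewrite addrAC subrr add0r.
  rewrite (le_trans hdec) // ler_pM2l // mulrDl mul1r lerD2l.
  rewrite /beta mulrA ler_pdivrMr // [leRHS]mulrC ler_pdivlMr ?exprn_gt0 //.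
- have href i := kl_word_law n r x0 e he (tapped W) q Delta k (w i) tW hq dq kq.
  have [qpmf _ _] := href ord0.
  have dom i : dominated (tap_law W c i) (ref_law n r x0 (tapped W) q k).
    by case: (href i).
  have /andP[-> h] /= := mutinfo_bounds W hW c _ qpmf dom.
  apply: (le_trans h); rewrite ler_pdivrMl ?ltr0n //.
  apply: (@le_trans _ _ (\sum_(i < K.+1) k%:R * Delta)).
    by apply: ler_sum => i _; case: (href i).
  by rewrite sumr_const card_ord -[leLHS]mulr_natl.
Qed.

(** The divergence bound of [good_messages]. It is affine in [I], so it stays o(n) when [I] does. *)
Definition leakage_bound (eta I : R) : R :=
  ln (8 / eta) + 8 / eta * (4 / eta * (I + 1) + 1).

(** The last hypothesis is the rate balance: per block, the lists cost [n] times the ball exponent,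
    factors of 2 cost [ln 4], discarded messages cost [- ln (eta / 8)], and tolerated misses a
    fraction 1 / j. *)
Lemma block_codes {n} (c : code n) (x0 : X) (eta kappa a s : R) (j k r : nat) :
    0 < eta -> eta <= Pc c -> 0 < kappa -> 0 <= a -> (0 < j)%N ->
    4 <= eta / 2 * kappa ^+ 2 * n%:R -> 4 <= 4 ^- j * kappa ^+ 2 * n%:R ->
    s * (block_length n r k)%:R +
      k%:R * (n%:R * (kappa * a + #|Y|%:R * expR (- a)) + ln 4) <=
      k%:R * ((1 - j%:R^-1) * (ln (msize c)%:R + ln (eta / 8))) ->
  exists c' : code (block_length n r k), [/\
    s * (block_length n r k)%:R <= ln (msize c')%:R, Pe c' <= 2 * 2 ^- k &
    0 <= mutinfo c' <= k%:R * leakage_bound eta (mutinfo c)].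
Proof.
move=> eta0 hPc ka0 a0 j0 n1 n2.
set N := block_length n r k; set lam := kappa * a + _ => hs.
have tau0 : 0 < 4 ^- j :> R by rewrite invr_gt0 exprn_gt0.
have [S [e [cS hS]]] := good_messages W hW c eta kappa (4 ^- j) eta0 hPc ka0 tau0 n1 n2.
have M0 : 0 < (msize c)%:R :> R by rewrite ltr0n; exact: msize_gt0.
have eta8 : 0 < eta / 8 by rewrite divr_gt0.
have S0' : 0 < #|S|%:R :> R by apply: lt_le_trans cS; rewrite mulr_gt0.
pose U : finType := {m | m \in S}.
have cU : #|U| = #|S| by rewrite card_sig; apply: eq_card => m.
have U0 : (0 < #|U|)%N by rewrite cU -(ltr0n R).
have U0' : 0 < #|U|%:R :> R by rewrite ltr0n.
have lnU : ln (msize c)%:R + ln (eta / 8) <= ln #|U|%:R.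
  by rewrite -lnM ?posrE // ler_ln ?posrE ?mulr_gt0 // cU.
have lnU0 : 0 <= ln #|U|%:R :> R by rewrite ln_ge0 // ler1n.
pose L y (u : U) := near_set kappa (fun y' => dec c y' == val u) y.
pose Lam : R := expR (n%:R * lam).
(* Every listed message is decoded from some word of the Hamming ball around [y]. *)
have cL y : #|[set u | L y u]|%:R <= Lam.
  apply: le_trans (card_ball_le y kappa a a0); rewrite ler_nat.
  rewrite -(card_imset _ val_inj).
  apply: leq_trans (leq_imset_card (dec c) _); apply: subset_leq_card.
  apply/fintype.subsetP => m /imsetP[u]; rewrite inE => /existsP[y' /andP[/eqP hy hd]] ->.
  by apply/imsetP; exists y'; rewrite ?inE.
have M0' : (0 < #|'I_(msize c)|)%N by rewrite card_ord; exact: msize_gt0.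
pose q := mixture (tap_law W c).
have hq : is_pmf q := mixture_pmf _ M0' (tap_law_pmf W hW c).
(* Rounding down keeps [K] below the packing bound, while the [K.+1] codewords exceed
   [expR (s * N%:R)]. *)
pose K := Num.truncn (expR (s * N%:R)).
have [u|u|u|u||c' [sz hPe hI]] := @outer_code U n r x0 (fun u => e (val u)) q
  L (leakage_bound eta (mutinfo c)) Lam j k K U0 j0 (expR_ge0 _) _ hq _ _ _ cL.
- by have [] := hS _ (valP u).
- by have [] := hS _ (valP u).
- by have [] := hS _ (valP u).
- by have [] := hS _ (valP u).
- have lam0 : 0 <= lam by rewrite /lam addr_ge0 ?mulr_ge0 ?expR_ge0 // ltW.
  have Lam1 : 1 <= Lam by rewrite -expR0 ler_expR mulr_ge0.
  have KE : K%:R <= expR (s * N%:R) by rewrite truncn_le expR_ge0.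
  have LamE : (Lam + 1) * 2 <= expR (n%:R * lam + ln 4).
    by rewrite expRD lnK ?posrE // -/Lam; lra.
  have UE m : #|U|%:R ^+ m = expR (m%:R * ln #|U|%:R) :> R by rewrite expRM_natl lnK ?posrE ?U0'.
  apply: (@le_trans _ _ (expR (s * N%:R) *
      (expR (k%:R * (n%:R * lam + ln 4)) * #|U|%:R ^+ (k %/ j)))).
    rewrite -mulrA mulrAC -exprMn; apply: ler_pM => //.
      by rewrite mulr_ge0 ?exprn_ge0 // mulr_ge0 //; lra.
    rewrite ler_wpM2r ?exprn_ge0 // expRM_natl.
    by apply: lerXn2r; rewrite ?nnegrE ?expR_ge0 // mulr_ge0 //; lra.
  rewrite !UE -!expRD ler_expR addrA; move: hs; rewrite -/N => hs.
  have kj : (k %/ j)%:R <= k%:R * j%:R^-1 :> R.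
    by rewrite ler_pdivlMr ?ltr0n // -natrM ler_nat leq_divM.
  have j1 : 0 <= k%:R * (1 - j%:R^-1) :> R.
    by rewrite mulr_ge0 // subr_ge0 invf_le1 ?ltr0n // ler1n.
  have h1 := ler_wpM2l j1 lnU; have h2 := ler_wpM2r lnU0 kj.
  by move: hs h1 h2; rewrite mulrA; lra.
exists c'; split=> //; rewrite sz -[leLHS]expRK ler_ln ?posrE ?expR_gt0 ?ltr0n //.
exact/ltW/truncnS_gt.
Qed.

End OuterCode.

(** * Diagonal extraction and upper limits *)

Section Sequences.
Context {R : realType}.
Local Open Scope classical_set_scope.
Local Open Scope ring_scope.

(** At index [N] an object is chosen that meets every tolerance 1 / (i + 1), i <= N, which some
    object there meets. *)
Lemma diagonal_sequence {T : nat -> Type} (P : R -> forall N, T N -> Prop) :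
    (forall g g' N c, g <= g' -> P g N c -> P g' N c) -> (forall N, T N) ->
    (forall g, 0 < g -> exists N0, forall N, (N0 <= N)%N -> exists c, P g N c) ->
  exists C : forall N, T N,
    forall g, 0 < g -> exists N0, forall N, (N0 <= N)%N -> P g N (C N).
Proof.
move=> Pmono C0 hP; pose g i : R := i.+1%:R^-1.
(* By monotonicity, meeting the finest attainable tolerance entails meeting the coarser ones. *)
have best N m : exists c, forall i, (i <= m)%N ->
    (exists c', P (g i) N c') -> P (g i) N c.
  elim: m => [|m [c hc]].
    have [[c hc]|h] := pselect (exists c', P (g 0%N) N c').
      by exists c => i; rewrite leqn0 => /eqP ->.
    by exists (C0 N) => i; rewrite leqn0 => /eqP ->.
  have [[c' hc']|h] := pselect (exists c', P (g m.+1) N c').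
    exists c' => i im _; apply: Pmono hc'.
    by rewrite lef_pV2 ?posrE ?ltr0n // ler_nat ltnS.
  exists c => i; rewrite leq_eqVlt => /predU1P[->//|]; exact: hc.
exists (fun N => projT1 (cid (best N N))) => gam gam0.
have [i hi] : exists i, g i <= gam.
  exists (Num.truncn gam^-1); rewrite -[leRHS]invrK lef_pV2 ?posrE ?invr_gt0 ?ltr0n //.
  exact/ltW/truncnS_gt.
have gi0 : 0 < g i by rewrite invr_gt0 ltr0n.
have [N0 hN0] := hP (g i) gi0.
exists (maxn i N0) => N; rewrite geq_max => /andP[iN N0N].
apply: Pmono hi _; case: cid => c /= hc; apply: hc => //; exact: hN0.
Qed.

Lemma limn_esup_le (u : nat -> R) (l : R) :
    (forall e, 0 < e -> exists N0, forall N, (N0 <= N)%N -> u N <= l + e) ->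
  (limn_esup (fun n => (u n)%:E) <= l%:E)%E.
Proof.
move=> h; apply/lee_addgt0Pr => e e0; have [N0 hN0] := h e e0.
apply: (@le_trans _ _ (ereal_sup [set (u n)%:E | n in [set n | (N0 <= n)%N]])).
  by apply: ereal_inf_lbound; exists [set n | (N0 <= n)%N] => //; exists N0.
by apply: ge_ereal_sup => _ [n /= hn <-]; rewrite -EFinD lee_fin hN0.
Qed.

Lemma limn_esup_lt_near (u : nat -> R) (l : R) :
  (limn_esup (fun n => (u n)%:E) < l%:E)%E -> \forall n \near \oo, u n < l.
Proof.
move=> /ereal_inf_lt[_ [V hV <-] hl]; apply: filterS hV => n Vn.
by rewrite -lte_fin; apply: le_lt_trans hl; apply: ereal_sup_ubound; exists n.
Qed.

End Sequences.

(** * Choice of parameters and the strong converse *)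

Section StrongConverse.
Context {R : realType} {X Y Z : finType} (W : X -> Y -> Z -> R).
Hypothesis hW : is_channel W.
Local Open Scope classical_set_scope.
Local Open Scope ring_scope.

Local Notation Pc := (Pc R X Y Z W).
Local Notation Pe := (Pe R X Y Z W).
Local Notation mutinfo := (mutinfoMZ R X Y Z W).
Local Notation code := (Defs.code R X Y).
Local Notation msize c := (msize R X Y _ c).

Lemma trivial_code (x0 : X) (N : nat) :
  exists c : code N, [/\ msize c = 1, Pe c <= 0 & mutinfo c <= 0].
Proof.
have hp := @point_pmf R X x0 N.
pose c : code N := Code R X Y N 1 isT (fun _ => point_law x0)
  (fun _ => proj1 hp) (fun _ => proj2 hp) (fun _ => ord0).
exists c; split=> //.
  rewrite /Defs.Pe Pc_out /= big_ord1 /= invr1 mul1r.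
  by rewrite (proj2 (pmf_out (legit_stochastic W hW) hp)) subrr.
have hq := tap_law_pmf W hW c ord0.
have dq m : dominated (tap_law W c m) (tap_law W c ord0) by [].
have /andP[_ h] := mutinfo_bounds W hW c _ hq dq.
by apply: (le_trans h); rewrite /= big_ord1 kl_self mulr0.
Qed.

(** One inner code of a fixed large length [n] serves all large [N]: write N = k n + r with r < n
    and let only [k] grow. *)
Lemma approx_codes (C : forall n, code n) (eta s s' gamma : R) :
    0 < eta -> eta <= 1 -> s < s' -> 0 < gamma ->
    (\forall n \near \oo, eta <= Pc (C n)) ->
    (\forall n \near \oo, s' <= ln (msize (C n))%:R / n%:R) ->
    (fun n => mutinfo (C n) / n%:R) @ \oo --> (0 : R) ->
  exists N0, forall N, (N0 <= N)%N -> exists c : code N,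
    [/\ s * N%:R <= ln (msize c)%:R, Pe c <= gamma & mutinfo c <= gamma * N%:R].
Proof.
move=> eta0 eta1 ss' g0 hPc hrate hI.
(* Length 1 is used because a word of length 0 exists even over an empty alphabet. *)
have x0 : X.
  have /cid[x] : exists x : {ffun 'I_1 -> X}, True; last by move=> _; exact: x ord0.
  apply: contrapT => h.
  have m := Ordinal (msize_gt0 _ _ _ _ (C 1%N)).
  have := enc_sum1 _ _ _ _ (C 1%N) m; rewrite big1 => [|x]; last by case: h; exists x.
  by move/eqP; rewrite eq_sym oner_eq0.
have [s0|s0] := leP s 0.
  exists 0%N => N _; have [c [h1 h2 h3]] := trivial_code x0 N; exists c; split.
  - by rewrite h1 ln1 mulr_le0_ge0.
  - exact: le_trans h2 (ltW g0).
  - by apply: (le_trans h3); rewrite mulr_ge0 // ltW.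
(* The rate gap is shared equally by four losses: padding, tolerated misses, lists and additive
   constants. *)
pose delta := (s' - s) / 4; have d0 : 0 < delta by rewrite /delta; lra.
have s'E : s' = s + 4 * delta by rewrite /delta; lra.
have s'0 : 0 < s' by lra.
pose j := (Num.truncn (s' / delta)).+1.
have jP : s' / j%:R <= delta.
  rewrite ler_pdivrMr ?ltr0n // mulrC -ler_pdivrMr //.
  exact/ltW/truncnS_gt.
have Y0 : 0 <= #|Y|%:R :> R by exact: ler0n.
(* [a] makes #|Y| exp (- a) at most [delta / 2] via exp a >= 1 + a; then [kappa] does the same for
   [kappa * a]. *)
pose a : R := 2 * #|Y|%:R / delta.
have a0 : 0 <= a by apply: divr_ge0; [exact: mulr_ge0|exact: ltW].
pose kappa := delta / (2 * (a + 1)).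
have ka0 : 0 < kappa by rewrite divr_gt0 //; lra.
pose lam : R := kappa * a + #|Y|%:R * expR (- a).
have lamP : lam <= delta.
  have h1 : kappa * a <= delta / 2.
    rewrite /kappa mulrAC ler_pdivrMr; last by lra.
    by rewrite (_ : delta / 2 * (2 * (a + 1)) = delta * (a + 1)) ?ler_pM2l //; [lra|field].
  have h2 : #|Y|%:R * expR (- a) <= delta / 2.
    rewrite expRN ler_pdivrMr ?expR_gt0 //.
    apply: (@le_trans _ _ (delta / 2 * (1 + a))).
      have : delta / 2 * a = #|Y|%:R by rewrite /a; field; lra.
      by lra.
    by rewrite ler_pM2l ?expR_ge1Dx //; lra.
  by rewrite /lam; lra.
(* The leakage bound is A + B I; [n] is taken so large that each summand is at most
   [gamma * n / 2]. *)
pose A := ln (8 / eta) + 8 / eta * (4 / eta + 1); pose B := 8 / eta * (4 / eta).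
have B0 : 0 < B by apply: mulr_gt0; apply: divr_gt0.
have hB : 0 < gamma / (2 * B) by apply: divr_gt0 => //; exact: mulr_gt0.
have c1 : 0 < eta / 2 * kappa ^+ 2 by apply: mulr_gt0; [lra|exact: exprn_gt0].
have c2 : 0 < 4 ^- j * kappa ^+ 2 by apply: mulr_gt0; rewrite ?invr_gt0 exprn_gt0.
have [n [[n0 hn1 hn2] [[hn3 hn4] [nPc nrate nI]]]] : exists n, [/\ 1 <= n%:R :> R,
    4 / (eta / 2 * kappa ^+ 2) <= n%:R & 4 / (4 ^- j * kappa ^+ 2) <= n%:R] /\
    ((ln 4 - ln (eta / 8)) / delta <= n%:R /\ 2 * A / gamma <= n%:R) /\
    [/\ eta <= Pc (C n), s' <= ln (msize (C n))%:R / n%:R &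
       `|0 - mutinfo (C n) / n%:R| <= gamma / (2 * B)].
  near \oo => n; exists n; split; [split|split; split];
    near: n; try exact: nbhs_infty_ger; [exact: hPc|exact: hrate|].
  by move/cvgrPdist_le: hI => /(_ _ hB).
have n00 : 0 < n%:R :> R by lra.
have hI0 : mutinfo (C n) <= gamma / (2 * B) * n%:R.
  move: nI; rewrite sub0r normrN => nI; rewrite -ler_pdivrMr //.
  exact: le_trans (ler_norm _) nI.
have leak : leakage_bound eta (mutinfo (C n)) <= gamma * n%:R.
  have -> : leakage_bound eta (mutinfo (C n)) = A + B * mutinfo (C n).
    by rewrite /leakage_bound /A /B; ring.
  have : B * mutinfo (C n) <= gamma * n%:R / 2.
    rewrite (_ : gamma * n%:R / 2 = B * (gamma / (2 * B) * n%:R)) ?ler_pM2l //.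
    by field; rewrite gt_eqF.
  by move: hn4; rewrite ler_pdivrMr //; lra.
(* [k >= s / delta] pays for the padding, and [k >= 2 / gamma] gives [2 * 2 ^- k <= gamma] since k <
   2^k. *)
pose k0 := (Num.truncn (s / delta) + Num.truncn (2 / gamma)).+1.
exists (k0 * n)%N => N hN.
have npos : (0 < n)%N by rewrite -(ltr0n R).
pose k := (N %/ n)%N; pose r := (N %% n)%N.
have k0k : (k0 <= k)%N by rewrite leq_divRL.
have rn : (r <= n)%N by rewrite ltnW // ltn_mod.
have kd : s / delta <= k%:R.
  apply/ltW/(lt_le_trans (truncnS_gt _)); rewrite ler_nat.
  by apply: leq_trans k0k; rewrite ltnS leq_addr.
have kg : 2 / gamma <= k%:R.
  apply/ltW/(lt_le_trans (truncnS_gt _)); rewrite ler_nat.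
  by apply: leq_trans k0k; rewrite ltnS leq_addl.
have EN : block_length n r k = N by rewrite block_lengthE -divn_eq.
have hs : s * (block_length n r k)%:R + k%:R * (n%:R * lam + ln 4) <=
    k%:R * ((1 - j%:R^-1) * (ln (msize (C n))%:R + ln (eta / 8))).
  have l0 : ln (eta / 8) <= 0 by apply: ln_le0; lra.
  have M1 : s' * n%:R <= ln (msize (C n))%:R by rewrite -ler_pdivlMr.
  have j0 : 0 < j%:R :> R by rewrite ltr0n.
  have ji0 : 0 <= j%:R^-1 :> R by rewrite invr_ge0 ltW.
  have ji1 : j%:R^-1 <= 1 :> R by rewrite invf_le1 // ler1n.
  have sr : s * r%:R <= k%:R * (delta * n%:R).
    move: kd; rewrite ler_pdivrMr // => kd; rewrite mulrA.
    by apply: ler_pM; rewrite ?ler_nat // ltW.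
  have h1 : delta * n%:R >= ln 4 - ln (eta / 8) by rewrite [delta * _]mulrC -ler_pdivrMr.
  have h2 : (1 - j%:R^-1) * (s' * n%:R + ln (eta / 8)) <=
      (1 - j%:R^-1) * (ln (msize (C n))%:R + ln (eta / 8)).
    by rewrite ler_wpM2l ?subr_ge0 // lerD2r.
  have h3 : s' * j%:R^-1 * n%:R <= delta * n%:R by rewrite ler_pM2r.
  have h4 : j%:R^-1 * ln (eta / 8) <= 0 by rewrite mulr_ge0_le0.
  have h5 : n%:R * lam <= n%:R * delta by rewrite ler_pM2l.
  have h6 : s * n%:R + n%:R * delta + n%:R * lam + ln 4 <=
      (1 - j%:R^-1) * (ln (msize (C n))%:R + ln (eta / 8)).
    apply: le_trans h2.
    have : s' * n%:R = s * n%:R + 4 * (delta * n%:R) by rewrite s'E; ring.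
    by lra.
  have h7 := ler_wpM2l (ler0n R k) h6.
  rewrite block_lengthE natrD natrM.
  by move: h7 sr; lra.
have n1 : 4 <= eta / 2 * kappa ^+ 2 * n%:R by move: hn1; rewrite ler_pdivrMr // mulrC.
have n2 : 4 <= 4 ^- j * kappa ^+ 2 * n%:R by move: hn2; rewrite ler_pdivrMr // mulrC.
rewrite -EN.
have [c [h1 h2 /andP[_ h3]]] :=
  block_codes W hW (C n) x0 eta kappa a s j k r eta0 nPc ka0 a0 isT n1 n2 hs.
exists c; split => //.
  apply: (le_trans h2).
  have k2 : 0 < 2 ^+ k :> R by rewrite exprn_gt0.
  rewrite ler_pdivrMr // mulrC -ler_pdivrMr // (le_trans kg) //.
  by rewrite -natrX ler_nat ltnW // ltn_expl.
apply: (le_trans h3); rewrite block_lengthE natrD natrM [leRHS]mulrDr -[leLHS]addr0 lerD //.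
  by rewrite mulrCA ler_wpM2l.
by rewrite mulr_ge0 // ltW.
Unshelve. all: by end_near.
Qed.

Lemma achievable_below (eps r s : R) : eps < 1 ->
  eps_achievable R X Y Z W eps r -> s < r -> eps_achievable R X Y Z W 0 s.
Proof.
move=> eps1 [C [hPe [hrate hI]]] sr.
pose P (g : R) (N : nat) (c : code N) :=
  [/\ s * N%:R <= ln (msize c)%:R, Pe c <= g & mutinfo c <= g * N%:R].
(* Eventually the error is below [(1 + eps) / 2], which leaves success probability at least
   [(1 - eps) / 2]. *)
pose eta := Num.min 1 ((1 - eps) / 2).
pose s' := (s + r) / 2.
have eta0 : 0 < eta by rewrite lt_min ltr01 /=; lra.
have Pmono g g' N c : g <= g' -> P g N c -> P g' N c.
  move=> gg [h1 h2 h3]; split=> //; first exact: le_trans gg.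
  by apply: (le_trans h3); rewrite ler_wpM2r.
have [|C' hC'] := diagonal_sequence P Pmono C.
  move=> g g0; apply: (approx_codes C eta s s') => //.
  - by rewrite ge_min lexx.
  - by rewrite /s'; lra.
  - have : (limn_esup (fun n => (Pe (C n))%:E) < ((1 + eps) / 2)%:E)%E.
      by apply: le_lt_trans hPe _; rewrite lte_fin; lra.
    move=> /limn_esup_lt_near; apply: filterS => n.
    by rewrite /Defs.Pe ge_min => h; apply/orP; right; lra.
  - have : (limn_esup (fun n => (- (ln (msize (C n))%:R / n%:R))%:E) < (- s')%:E)%E.
      rewrite EFinN lteNr; apply: lt_le_trans hrate; rewrite lte_fin /s'; lra.
    by move=> /limn_esup_lt_near; apply: filterS => n; rewrite ltrN2 => /ltW.
exists C'; split; last split.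
- apply: limn_esup_le => e e0; have [N0 h] := hC' e e0.
  by exists N0 => N /h[_ h2 _]; rewrite add0r.
(* The rate bound in [P] is the same for all tolerances, so tolerance 1 will do. *)
- rewrite leeNr -EFinN; apply: limn_esup_le => e e0; have [N0 h] := hC' 1 ltr01.
  exists N0.+1 => N hN; have [h1 _ _] := h N (ltnW hN).
  have N0' : 0 < N%:R :> R by rewrite ltr0n (leq_trans _ hN).
  have : s <= ln (msize (C' N))%:R / N%:R by rewrite ler_pdivlMr.
  by lra.
- apply/cvgrPdist_le => e e0; have [N0 h] := hC' e e0.
  exists N0.+1 => // N /= hN; have [_ _ h3] := h N (ltnW hN).
  have N0' : 0 < N%:R :> R by rewrite ltr0n (leq_trans _ hN).
  rewrite sub0r normrN ger0_norm ?ler_pdivrMr //.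
  by rewrite divr_ge0 // mutinfo_ge0.
Qed.

End StrongConverse.

Theorem theorem1 (R : realType) (X Y Z : finType) (W : X -> Y -> Z -> R)
  (hW : is_channel W) (eps : R) (heps0 : 0 <= eps) (heps1 : eps < 1) :
  Cs W eps = Cs W 0.
Proof.
apply/eqP; rewrite eq_le; apply/andP; split.
  (* An arbitrarily small loss of rate does not change the supremum. *)
  apply: ge_ereal_sup => _ [r hr <-]; apply/lee_addgt0Pr => e e0.
  rewrite -leeBlDr // -EFinB; apply: ereal_sup_ubound; exists (r - e) => //=.
  by apply: (achievable_below W hW eps r); rewrite // ltrBlDr ltrDl.
apply: ereal_sup_le => _ [r [C [h1 [h2 h3]]] <-]; exists r => //=.
by exists C; split=> //; apply: (le_trans h1); rewrite lee_fin.
Qed.
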